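(* Let $\Sigma$ be distributed according to the uniform biased sparse PCA (UBSPCA) model with parameters $n,p,k,\beta$. Assume that $p/n\to c\ge 0$ and that $k\le\frac{n\cdot\min\{\beta^2,\beta\}}{C\log n}$ for a sufficiently large universal constant $C$. If $$k^*\ge\Bigl\lfloor\frac{Ck^2\log n}{\beta^2 n}\Bigr\rfloor,$$ then with probability tending to $1$ as $(n,p,k)\to\infty$ there exists a seed $\mathcal{S}^*\subseteq\mathcal{I}^*$ of size at most $k^*$ for which the output of GreedySPCA$(f_{avg},\mathcal{S}^*,k)$ is $\mathcal{I}^*$.
   Context: UBSPCA model: $\mathbf{v}^*\in\mathbb{R}^p$ is a unit vector with exactly $k$ non-zero entries, all equal to $1/\sqrt{k}$, and $\mathcal{I}^*\subseteq\{1,\ldots,p\}$ is its support, $|\mathcal{I}^*|=k$. The signal strength is $\beta\ge0$. The samples $\mathbf{x}_1,\ldots,\mathbf{x}_n\in\mathbb{R}^p$ are i.i.d. from $\mathcal{N}(0,\beta\mathbf{v}^*{\mathbf{v}^*}^T+I_p)$, $X$ is the $n\times p$ matrix whose rows are the samples, and $\Sigma=\frac1n X^TX$. Probability is over the choice of $X$. For $\mathcal{S}\subseteq\{1,\ldots,p\}$, $f_{avg}(\mathcal{S})=\frac{1}{|\mathcal{S}|}\sum_{i,j\in\mathcal{S}}\Sigma_{i,j}$. GreedySPCA$(f,\mathcal{S}^*,k)$: the input is a function $f:2^{\{1,\ldots,p\}}\to\mathbb{R}$, a seed $\mathcal{S}^*\subseteq\{1,\ldots,p\}$ (possibly empty)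 with $|\mathcal{S}^*|\le k$, and the solution size $k$. For each $i\in\{1,\ldots,p\}\setminus\mathcal{S}^*$ compute $a_i=f(\mathcal{S}^*\cup\{i\})$; sort these in non-increasing order as $a_{i_1}\ge a_{i_2}\ge\cdots$; output $\mathcal{S}^*\cup\{i_1,\ldots,i_{k-|\mathcal{S}^*|}\}$. *)

(* Defs.v *)
From mathcomp Require Export all_boot all_order all_algebra.
From mathcomp Require Export all_classical all_reals all_analysis.
Export Order.TTheory GRing.Theory Num.Theory.
Export numFieldNormedType.Exports.

Set Implicit Arguments.
Unset Strict Implicit.
Unset Printing Implicit Defensive.

Local Open Scope classical_set_scope.
Local Open Scope ring_scope.

(* One-dimensional N(mu, var). [normal_prob] takes a standard deviation, and at
   standard deviation 0 it is not the point mass, hence the case distinction. *)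
Definition gauss1 (R : realType) (mu var : R) : set R -> \bar R :=
  if var == 0 then \d_mu else normal_prob mu (Num.sqrt var).

(* Random vectors are tuple-valued because tuples carry the product
   sigma-algebra in the library; row vectors do not. *)
Definition rv_of_tuple (R : realType) p (x : p.-tuple R) : 'rV[R]_p :=
  \row_j tnth x j.

(* The law of Y is N(mu, V) when every linear form a of Y has law
   N(a . mu, a V a^T). *)
Definition gaussian_vector d (T : measurableType d) (R : realType)
    (P : probability T R) p (Y : {RV P >-> p.-tuple R})
    (mu : 'rV[R]_p) (V : 'M[R]_p) : Prop :=
  forall (a : 'rV[R]_p) (B : set R), measurable B ->
    P ((fun w => (a *m (rv_of_tuple (Y w))^T) 0 0) @^-1` B)
    = gauss1 ((a *m mu^T) 0 0) ((a *m V *m a^T) 0 0) B.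

(* For a finite family the product rule for subfamilies is the case where some
   of the A i are the whole space. *)
Definition mutually_independent d (T : measurableType d) (R : realType)
    (P : probability T R) d' (T' : measurableType d') (I : finType)
    (Y : I -> {RV P >-> T'}) : Prop :=
  forall A : I -> set T', (forall i, measurable (A i)) ->
    P (\bigcap_i (Y i @^-1` A i)) = (\prod_(i : I) P (Y i @^-1` A i))%E.

Definition vsupp (R : realType) p (v : 'cV[R]_p) : {set 'I_p} :=
  [set i | v i 0 != 0]%SET.

Definition uniform_biased_spike (R : realType) p (k : nat) (v : 'cV[R]_p) : Prop :=
  [/\ \sum_i v i 0 ^+ 2 = 1,
      #|vsupp v| = k &
      forall i, i \in vsupp v -> v i 0 = (Num.sqrt k%:R)^-1].

Definition UBSPCA d (T : measurableType d) (R : realType)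
    (P : probability T R) (n p k : nat) (beta : R) (v : 'cV[R]_p)
    (x : 'I_n -> {RV P >-> p.-tuple R}) : Prop :=
  [/\ 0 <= beta,
      uniform_biased_spike k v,
      mutually_independent x &
      forall i, gaussian_vector (x i) 0 (beta *: (v *m v^T) + 1%:M)].

Definition data_matrix d (T : measurableType d) (R : realType)
    (P : probability T R) (n p : nat)
    (x : 'I_n -> {RV P >-> p.-tuple R}) (w : T) : 'M[R]_(n, p) :=
  \matrix_(i, j) tnth (x i w) j.

Definition sample_cov (R : realType) n p (X : 'M[R]_(n, p)) : 'M[R]_p :=
  n%:R^-1 *: (X^T *m X).

Definition favg (R : realType) p (Sigma : 'M[R]_p) (S : {set 'I_p}) : R :=
  #|S|%:R^-1 * \sum_(i in S) \sum_(j in S) Sigma i j.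

(* U is a possible output of GreedySPCA(f, S, k); ties among the values
   f (S + i) may be broken in any way by the sorting step, hence a relation. *)
Definition greedy_output (R : realType) p (f : {set 'I_p} -> R)
    (S : {set 'I_p}) (k : nat) (U : {set 'I_p}) : Prop :=
  exists s : seq 'I_p,
    [/\ perm_eq s (enum (~: S)%SET),
        sorted (fun i j => f (j |: S)%SET <= f (i |: S)%SET) s &
        U = (S :|: [set i in take (k - #|S|) s])%SET].

(* Whichever way ties are broken, GreedySPCA(f, S, k) outputs U. *)
Definition greedy_spca (R : realType) p (f : {set 'I_p} -> R)
    (S : {set 'I_p}) (k : nat) (U : {set 'I_p}) : Prop :=
  forall U', greedy_output f S k U' <-> U' = U.

(* Main.v *)
Require Import Defs.
From mathcomp Require Import finmap measurable_realfun ring lra.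

(* Fix S inside the support I* with s = |S| about C k^2 ln n / (beta^2 n), and
   let y be the sum over S of the coordinates of a sample. Up to a positive
   factor and a term that do not depend on i, favg (S + i) is the empirical
   mean of x_i^2 + 2 x_i y. Its expectation is 1 outside I* and 1 + beta (2 s
   + 1) / k on I* \ S. By polarisation, 4 r x_i y = (r x_i + y)^2 - (r x_i -
   y)^2, so the fluctuation is controlled by three sums of squares of i.i.d.
   centred Gaussians, each of which has relative error at most e = sqrt (32 ln
   n / n) outside an event of probability 2 n^-2 (Chernoff). With r = sqrt (s
   + 1) the errors are smaller than the gap, and a union bound over the 3 p
   forms concludes. The case s = 0 is not special. *)

Set Implicit Arguments.
Unset Strict Implicit.
Unset Printing Implicit Defensive.

Local Open Scope classical_set_scope.
Local Open Scope ring_scope.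

(** * From indicators to nonnegative functions: integrals and independence *)

Section simple_approximation.
Import HBNNSimple.

(* Used with T1 = T2 to replace one factor of a product at a time, and with
   W2 a density to integrate against a law that has one. *)
Lemma eq_integral_weight_indic (R : realType) d1 (T1 : measurableType d1)
    d2 (T2 : measurableType d2) d' (T' : measurableType d')
    (mu1 : {measure set T1 -> \bar R}) (mu2 : {measure set T2 -> \bar R})
    (Y1 : T1 -> T') (Y2 : T2 -> T') (W1 : T1 -> R) (W2 : T2 -> R) (f : T' -> R) :
  measurable_fun setT Y1 -> measurable_fun setT Y2 ->
  measurable_fun setT W1 -> measurable_fun setT W2 -> measurable_fun setT f ->
  (forall t, 0 <= W1 t) -> (forall t, 0 <= W2 t) -> (forall y, 0 <= f y) ->
  (forall A, measurable A -> (\int[mu1]_t (W1 t * \1_A (Y1 t))%:E =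
                              \int[mu2]_t (W2 t * \1_A (Y2 t))%:E)%E) ->
  (\int[mu1]_t (W1 t * f (Y1 t))%:E = \int[mu2]_t (W2 t * f (Y2 t))%:E)%E.
Proof.
move=> mY1 mY2 mW1 mW2 mf W1ge0 W2ge0 f0 W12.
have mEf : measurable_fun setT (EFin \o f : T' -> \bar R).
  exact/measurable_EFinP.
pose h := nnsfun_approx measurableT mEf.
have hf y : (h n y)%:E @[n --> \oo] --> (f y)%:E.
  exact: (@cvg_nnsfun_approx _ _ _ _ measurableT _ mEf (fun y _ => f0 y)).
(* Monotone convergence reduces both sides to the same simple functions [h n], since these depend on
   [f] only. *)
have lim d (T : measurableType d) (mu : {measure set T -> \bar R})
    (W : T -> R) (Y : T -> T') :
    measurable_fun setT Y -> measurable_fun setT W -> (forall t, 0 <= W t) ->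
    (\int[mu]_t (W t * f (Y t))%:E =
     limn (fun n => \int[mu]_t (W t * h n (Y t))%:E))%E.
  move=> mY mW W0; under eq_integral => t _.
    have <- : limn (fun n => (W t * h n (Y t))%:E) = (W t * f (Y t))%:E.
      apply/cvg_lim => //; under eq_fun do rewrite EFinM.
      by rewrite EFinM; apply: cvgeZl => //; exact: hf.
    over.
  apply: monotone_convergence => //.
  - move=> n; apply/measurable_EFinP; apply: measurable_funM => //.
    by apply: measurableT_comp => //.
  - by move=> n t _; rewrite lee_fin mulr_ge0.
  - move=> t _ a b ab; rewrite lee_fin ler_wpM2l//.
    exact/lefP/nd_nnsfun_approx.
rewrite !lim//; congr (limn _); apply/funext => n.
pose s := fset_set (range (h n)).
(* A simple function is a finite combination of indicators of its level sets, so [W12] applies term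
   by term. *)
have simple d (T : measurableType d) (mu : {measure set T -> \bar R})
    (W : T -> R) (Y : T -> T') :
    measurable_fun setT Y -> measurable_fun setT W -> (forall t, 0 <= W t) ->
    (\int[mu]_t (W t * h n (Y t))%:E =
    \sum_(i < #|` s|) ((s`_i)%R%:E *
      \int[mu]_t (W t * \1_(h n @^-1` [set s`_i]) (Y t))%:E))%E.
  move=> mY mW W0.
  have s0 (i : 'I_#|` s|) : 0 <= s`_i.
    have : s`_i \in s by exact: mem_nth.
    by rewrite in_fset_set// => /set_mem[y _ <-].
  have mind (i : 'I_#|` s|) : measurable_fun setT
      (fun t => W t * \1_(h n @^-1` [set s`_i]) (Y t)).
    apply: measurable_funM => //.
    by apply: measurableT_comp => //; exact: measurable_indic.
  under eq_integral => t _.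
    rewrite fimfunEord -/s mulr_sumr -sumEFin.
    under eq_bigr do rewrite mulrCA EFinM.
    over.
  rewrite ge0_integral_sum//.
  - apply: eq_bigr => i _; rewrite ge0_integralZl_EFin//.
    + by move=> t _; rewrite lee_fin mulr_ge0.
    + exact/measurable_EFinP.
  - by move=> i; apply: measurable_funeM; exact/measurable_EFinP.
  - by move=> i t _; rewrite mule_ge0// lee_fin// mulr_ge0.
rewrite !simple//; apply: eq_bigr => i _; rewrite W12//.
Qed.

End simple_approximation.

Lemma integral_indic_comp d (T : measurableType d) d' (T' : measurableType d')
    (R : realType) (mu : {measure set T -> \bar R}) (Y : T -> T') (A : set T') :
  measurable_fun setT Y -> measurable A ->
  (\int[mu]_t (\1_A (Y t))%:E = mu (Y @^-1` A))%E.
Proof.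
move=> mY mA; rewrite -[LHS]/(\int[mu]_t (\1_(Y @^-1` A) t)%:E)%E.
by rewrite integral_indic ?setIT// -[X in measurable X]setTI; exact: mY.
Qed.

(** Independence is known on events only. Replacing one factor at a time by an indicator, with the
    product of the others as weight in [eq_integral_weight_indic], extends the product rule to
    nonnegative functions. It serves to factor the exponential moment of a sum. *)
Lemma expectation_prod_indep d (T : measurableType d) (R : realType)
    (P : probability T R) d' (T' : measurableType d')
    (I : finType) (Y : I -> T -> T') (f : I -> T' -> R) (m : I -> R) :
  (forall i, measurable_fun setT (Y i)) ->
  (forall A : I -> set T', (forall i, measurable (A i)) ->
    P (\bigcap_i (Y i @^-1` A i)) = (\prod_i P (Y i @^-1` A i))%E) ->
  (forall i, measurable_fun setT (f i)) -> (forall i y, 0 <= f i y) ->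
  (forall i, (\int[P]_t (f i (Y i t))%:E = (m i)%:E)%E) ->
  (\int[P]_t (\prod_i f i (Y i t))%:E = (\prod_i m i)%:E)%E.
Proof.
move=> mY indepY mf f0 fm.
(* Induction on the number of factors that are not indicators. *)
suff H (n : nat) : forall (J : {set I}) (g : I -> T' -> R) (a : I -> R),
    #|J| = n ->
    (forall i, i \notin J -> exists2 A, measurable A & g i = \1_A) ->
    (forall i, measurable_fun setT (g i)) -> (forall i y, 0 <= g i y) ->
    (forall i, (\int[P]_t (g i (Y i t))%:E = (a i)%:E)%E) ->
    (\int[P]_t (\prod_i g i (Y i t))%:E = (\prod_i a i)%:E)%E.
  by apply: (H #|[set: I]%SET| [set: I]%SET) => // i; rewrite inE.
elim: n => [|n IH] J g a Jn gA mg g0 ga.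
  move/cards0_eq : Jn gA => -> gA.
  have {}gA i : exists A, measurable A /\ g i = \1_A.
    by have [|A mA gi] := gA i; [rewrite inE|exists A].
  have [A /all_and2[mA gE]] := choice gA.
  have mYA i : measurable (Y i @^-1` A i).
    by rewrite -[X in measurable X]setTI; exact: mY.
  have aE i : P (Y i @^-1` A i) = (a i)%:E.
    by rewrite -ga gE integral_indic_comp.
  transitivity (P (\bigcap_i (Y i @^-1` A i))); last first.
    rewrite indepY// -prodEFin; exact: eq_bigr.
  have mcap : measurable (\bigcap_i (Y i @^-1` A i)).
    exact: fin_bigcap_measurable.
  rewrite -[X in P X]setIT -integral_indic//; apply: eq_integral => t _.
  congr (_%:E); rewrite indicE; case: (boolP (t \in _)) => [/set_mem tA|/negP tA].
    apply: big1 => i _.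
    by rewrite gE indicE mem_set//; exact: tA.
  have [i tAi] : exists i, ~ A i (Y i t).
    by apply/existsNP => tA'; apply: tA; apply/mem_set => i _; exact: tA'.
  by rewrite (bigD1 i)//= gE indicE memNset// mul0r.
have [i0 i0J] : exists i, i \in J by apply/card_gt0P; rewrite Jn.
pose b := \prod_(i | i != i0) a i.
have a_ge0 i : 0 <= a i.
  by rewrite -lee_fin -ga integral_ge0// => t _; rewrite lee_fin.
have b_ge0 : 0 <= b by exact: prodr_ge0.
pose W t := \prod_(i | i != i0) g i (Y i t).
have mW : measurable_fun setT W.
  rewrite (_ : W = fun t => \prod_i (if i != i0 then g i (Y i t) else 1)); last first.
    by apply/funext => t; exact: big_mkcond.
  apply: measurable_prod => i _; case: (i != i0); last exact: measurable_cst.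
  exact: measurableT_comp.
under eq_integral do rewrite (bigD1 i0)//= mulrC -/(W _).
rewrite (@eq_integral_weight_indic _ _ _ _ _ _ _ P P (Y i0) (Y i0) W (cst b) (g i0))//.
- rewrite (bigD1 i0)//= mulrC EFinM -ga -/b; under eq_integral do rewrite EFinM.
  rewrite ge0_integralZl_EFin//.
  + by move=> t _; rewrite lee_fin.
  + by apply/measurable_EFinP; exact: measurableT_comp.
- by move=> t; exact: prodr_ge0.
- move=> A mA.
  have mYA : measurable (Y i0 @^-1` A).
    by rewrite -[X in measurable X]setTI; exact: mY.
  (* With the factor at [i0] turned into an indicator, one non-indicator factor fewer is left and
     the induction hypothesis applies; [a'] holds the new means. *)
  pose g' i := if i == i0 then \1_A : T' -> R else g i.
  pose a' i := if i == i0 then fine (P (Y i0 @^-1` A)) else a i.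
  have PA : (\int[P]_t (\1_A (Y i0 t))%:E = P (Y i0 @^-1` A))%E.
    exact: integral_indic_comp.
  transitivity (\prod_i a' i)%:E.
    rewrite -(IH (J :\ i0)%SET g')//.
    + apply: eq_integral => t _; rewrite (bigD1 i0)//= /g' eqxx mulrC.
      by congr (_ * _)%:E; apply: eq_bigr => i /negbTE ->.
    + by apply/eqP; rewrite -eqSS -Jn (cardsD1 i0 J) i0J.
    + move=> i; rewrite !inE /g'; case: eqVneq => [_ _|_ /= iJ]; last exact: gA.
      by exists A.
    + by move=> i; rewrite /g'; case: ifP => // _; exact: measurable_indic.
    + by move=> i y; rewrite /g'; case: ifP.
    + move=> i; rewrite /g' /a'; case: eqVneq => [->|_//].
      by rewrite PA fineK// fin_num_measure.
  rewrite (bigD1 i0)//= /a' eqxx mulrC EFinM fineK ?fin_num_measure// -PA.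
  rewrite (_ : \prod_(i | _) _ = b); last by apply: eq_bigr => i /negbTE ->.
  under [RHS]eq_integral do rewrite EFinM.
  rewrite ge0_integralZl_EFin//.
  apply/measurable_EFinP; apply: measurableT_comp => //; exact: measurable_indic.
Qed.

(** * Concentration of sums of squared Gaussians *)

(** Tilting a centred Gaussian density by the exponential of its normalised square only rescales the
    standard deviation; the leftover factor [q^-1] is the moment generating function of a squared
    standard normal variable. *)
Lemma normal_pdf_tilt (R : realType) (s q lam x : R) :
  0 < s -> 0 < q -> q ^+ 2 = 1 - 2 * lam ->
  normal_pdf 0 s x * expR (lam * (x / s) ^+ 2) = q^-1 * normal_pdf 0 (s / q) x.
Proof.
move=> s0 q0 q2.
have sq0 : 0 < s / q by rewrite divr_gt0.
rewrite !normal_pdfE ?gt_eqF// /normal_peak /normal_fun !subr0.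
rewrite -mulrA -expRD [RHS]mulrA.
have -> : Num.sqrt ((s / q) ^+ 2 * pi *+ 2) = q^-1 * Num.sqrt (s ^+ 2 * pi *+ 2).
  have -> : (s / q) ^+ 2 * pi *+ 2 = (q^-1) ^+ 2 * (s ^+ 2 * pi *+ 2).
    by ring.
  by rewrite sqrtrM ?sqr_ge0// sqrtr_sqr ger0_norm// invr_ge0 ltW.
rewrite invfM invrK mulKf ?gt_eqF//; congr (_ * expR _).
have -> : lam = (1 - q ^+ 2) / 2 by rewrite q2; field.
by field; rewrite !gt_eqF.
Qed.

Section gaussian_squares.
Context d (T : measurableType d) (R : realType) (P : probability T R).

(** The tilted density has total mass one, so only [q^-1] survives; [lam < 2^-1] keeps [q]
    positive. *)
Lemma expectation_expR_normal_sqr (Z : T -> R) (s lam : R) :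
  measurable_fun setT Z -> 0 < s -> lam < 2^-1 ->
  (forall B, measurable B -> P (Z @^-1` B) = normal_prob 0 s B) ->
  (\int[P]_t (expR (lam * (Z t / s) ^+ 2))%:E =
   (Num.sqrt (1 - 2 * lam))^-1%:E)%E.
Proof.
move=> mZ s0 lamlt lawZ.
pose q := Num.sqrt (1 - 2 * lam).
have q2 : q ^+ 2 = 1 - 2 * lam by rewrite sqr_sqrtr//; lra.
have q0 : 0 < q by rewrite sqrtr_gt0; lra.
pose f (x : R) := expR (lam * (x / s) ^+ 2).
have mf : measurable_fun setT f.
  apply: measurableT_comp => //; apply: measurable_funM => //.
  by apply: measurable_funX; exact: measurable_funM.
transitivity (\int[P]_t (cst 1 t * f (Z t))%:E)%E.
  by apply: eq_integral => t _; rewrite mul1r.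
rewrite (@eq_integral_weight_indic _ _ _ _ _ _ _ P lebesgue_measure Z idfun
  (cst 1) (normal_pdf 0 s) f)//; first last.
- move=> A mA; under eq_integral do rewrite mul1r.
  transitivity (normal_prob 0 s A); first by rewrite -lawZ// integral_indic_comp.
  rewrite /normal_prob [LHS]integral_mkcond; apply: eq_integral => x _.
  by rewrite patchE indicE; case: ifP => _; rewrite ?mulr1 ?mulr0.
- by move=> x; exact: expR_ge0.
- by move=> x; exact: normal_pdf_ge0.
- exact: measurable_normal_pdf.
- exact: measurable_id.
transitivity (\int[lebesgue_measure]_x
    (q^-1%:E * (normal_pdf 0 (s / q) x)%:E))%E.
  apply: eq_integral => x _; rewrite -EFinM; congr (_%:E).
  exact: normal_pdf_tilt.
rewrite ge0_integralZl_EFin//.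
- by rewrite integral_normal_pdf mule1.
- by move=> x _; rewrite lee_fin normal_pdf_ge0.
- by apply/measurable_EFinP; exact: measurable_normal_pdf.
- by rewrite invr_ge0 ltW.
Qed.

(** After squaring, [1 / (1 - 2 lam) = 1 + u <= expR u] with [u = 2 lam / (1 - 2 lam)], and
    [u <= 2 (lam + 4 lam^2)] because the remainder [lam^2 (4 - 16 lam)] is nonnegative for
    [lam <= 1/4]. *)
Lemma invr_sqrt_le_expR (lam : R) : `|lam| <= 4^-1 ->
  (Num.sqrt (1 - 2 * lam))^-1 <= expR (lam + 4 * lam ^+ 2).
Proof.
rewrite ler_norml => /andP[lamge lamle].
have u0 : 0 < 1 - 2 * lam by lra.
rewrite -ler_sqr ?nnegrE ?invr_ge0 ?sqrtr_ge0 ?expR_ge0//.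
rewrite exprVn sqr_sqrtr; last exact: ltW.
rewrite -expRM_natl.
apply: (@le_trans _ _ (expR (2 * lam / (1 - 2 * lam)))).
  apply: le_trans (expR_ge1Dx _).
  have -> : 1 + 2 * lam / (1 - 2 * lam) = (1 - 2 * lam)^-1 by field; lra.
  exact: lexx.
rewrite ler_expR ler_pdivrMr//.
have : 0 <= lam ^+ 2 by exact: sqr_ge0.
have -> : 2%:R * (lam + 4 * lam ^+ 2) * (1 - 2 * lam) =
   2 * lam + lam ^+ 2 * (4 - 16 * lam) by ring.
move=> l2; rewrite lerDl mulr_ge0//; lra.
Qed.

(* The two signs of lam give the two tails. *)
Lemma normal_sqr_chernoff n (Z : 'I_n -> T -> R) (s lam : R) :
  (forall i, measurable_fun setT (Z i)) -> 0 < s -> `|lam| <= 4^-1 ->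
  (forall i B, measurable B -> P (Z i @^-1` B) = normal_prob 0 s B) ->
  (forall A : 'I_n -> set R, (forall i, measurable (A i)) ->
    P (\bigcap_i (Z i @^-1` A i)) = (\prod_i P (Z i @^-1` A i))%E) ->
  (P [set w | (n%:R * (lam + 8 * lam ^+ 2) <= \sum_i lam * (Z i w / s) ^+ 2)%R]
   <= (expR (- (4 * n%:R * lam ^+ 2)))%:E)%E.
Proof.
move=> mZ s0 laml lawZ indepZ.
pose f (i : 'I_n) (x : R) := expR (lam * (x / s) ^+ 2).
have mf i : measurable_fun setT (f i).
  apply: measurableT_comp => //; apply: measurable_funM => //.
  by apply: measurable_funX; exact: measurable_funM.
set c := n%:R * (lam + 8 * lam ^+ 2).
have Ef i : (\int[P]_t (f i (Z i t))%:E = (Num.sqrt (1 - 2 * lam))^-1%:E)%E.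
  apply: expectation_expR_normal_sqr => //.
    by move: laml; rewrite ler_norml => /andP[]; lra.
  exact: lawZ.
have H := expectation_prod_indep mZ indepZ mf (fun i y => expR_ge0 _) Ef.
set E := [set w | _].
have mS : measurable_fun setT (fun w => \sum_i lam * (Z i w / s) ^+ 2).
  apply: measurable_sum => i; apply: measurable_funM => //.
  by apply: measurable_funX; exact: measurable_funM.
have mE : measurable E.
  by rewrite -[X in measurable X]setTI; apply: measurable_fun_le.
rewrite -[E]setIT -integral_indic//.
(* Exponential Markov inequality: the indicator of [E] is at most [expR (- c)] times the product. *)
apply: (@le_trans _ _
  (\int[P]_t ((expR (- c))%:E * (\prod_i f i (Z i t))%:E))%E).
  apply: ge0_le_integral => //.
  - by apply/measurable_EFinP; exact: measurable_indic.
  - apply: measurable_funeM; apply/measurable_EFinP.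
    by apply: measurable_prod => i _; exact: measurableT_comp.
  - move=> t _; rewrite -EFinM lee_fin -expR_sum -expRD indicE.
    case: (boolP (t \in E)) => [/set_mem tE|_]; last exact: expR_ge0.
    by rewrite -[X in X <= _]expR0 ler_expR addrC subr_ge0.
rewrite ge0_integralZl_EFin ?expR_ge0//.
- rewrite H -EFinM lee_fin prodr_const card_ord.
  apply: (@le_trans _ _ (expR (- c) * expR (lam + 4 * lam ^+ 2) ^+ n)).
    rewrite ler_wpM2l ?expR_ge0// lerXn2r ?nnegrE ?expR_ge0 ?invr_ge0 ?sqrtr_ge0//.
    exact: invr_sqrt_le_expR.
  (* The threshold has [8 lam^2], the moment bound [4 lam^2]; the difference leaves [- 4 n lam^2] in
     the exponent. *)
  rewrite -expRM_natl -expRD ler_expR le_eqVlt; apply/orP; left; apply/eqP.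
  rewrite /c; ring.
- by move=> t _; rewrite lee_fin prodr_ge0// => i _; exact: expR_ge0.
- apply/measurable_EFinP.
  by apply: measurable_prod => i _; exact: measurableT_comp.
Qed.

(** Chernoff with [lam = e / 8] and [lam = - e / 8]: for the normalised sum the thresholds are
    [n (1 + e)] and [n (1 - e)], the exponent is [n e^2 / 16], and [e <= 2] gives [|lam| <= 1/4]. *)
Lemma normal_sqr_concentration n (Z : 'I_n -> T -> R) (s e : R) :
  (forall i, measurable_fun setT (Z i)) -> 0 < s -> 0 < e <= 2 ->
  (forall i B, measurable B -> P (Z i @^-1` B) = normal_prob 0 s B) ->
  (forall A : 'I_n -> set R, (forall i, measurable (A i)) ->
    P (\bigcap_i (Z i @^-1` A i)) = (\prod_i P (Z i @^-1` A i))%E) ->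
  (P [set w | (e * (n%:R * s ^+ 2) <=
               `| \sum_i Z i w ^+ 2 - n%:R * s ^+ 2 |)%R]
   <= (2 * expR (- (n%:R * e ^+ 2 / 16)))%:E)%E.
Proof.
move=> mZ s0 /andP[e0 e2] lawZ indepZ.
have mS lam : measurable_fun setT (fun w => \sum_i lam * (Z i w / s) ^+ 2).
  apply: measurable_sum => i; apply: measurable_funM => //.
  by apply: measurable_funX; exact: measurable_funM.
pose E lam := [set w | n%:R * (lam + 8 * lam ^+ 2) <=
                       (\sum_i lam * (Z i w / s) ^+ 2)].
have mE lam : measurable (E lam).
  by rewrite -[X in measurable X]setTI; apply: measurable_fun_le.
have PE lam : `|lam| = e / 8 ->
    (P (E lam) <= (expR (- (n%:R * e ^+ 2 / 16)))%:E)%E.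
  move=> le; apply: le_trans (normal_sqr_chernoff mZ s0 _ lawZ indepZ) _.
    by rewrite le; lra.
  rewrite lee_fin ler_expR -(real_normK (num_real lam)) le.
  rewrite le_eqVlt; apply/orP; left; apply/eqP.
  by field.
set F := [set w | _].
have FE : F `<=` E (e / 8) `|` E (- (e / 8)).
  move=> w; rewrite /F /E /= -!mulr_sumr.
  set S2 := \sum_i (Z i w / s) ^+ 2.
  have -> : \sum_i Z i w ^+ 2 = s ^+ 2 * S2.
    rewrite mulr_sumr; apply: eq_bigr => i _.
    by rewrite -exprMn mulrCA divff ?mulr1// gt_eqF.
  have -> : s ^+ 2 * S2 - n%:R * s ^+ 2 = s ^+ 2 * (S2 - n%:R) by ring.
  have s20 : 0 < s ^+ 2 by exact: exprn_gt0.
  rewrite normrM (gtr0_norm s20) mulrCA mulrA mulrC ler_pM2l//.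
  rewrite ler_normr => /orP[] h; [left|right].
    have : e / 8 * (n%:R * e) <= e / 8 * (S2 - n%:R) by rewrite ler_pM2l//; lra.
    nra.
  have : e / 8 * (n%:R * e) <= e / 8 * (- (S2 - n%:R)) by rewrite ler_pM2l//; lra.
  nra.
have mF : measurable F.
  rewrite -[X in measurable X]setTI; apply: measurable_fun_le => //.
  apply: measurableT_comp => //; apply: measurable_funB => //.
  by apply: measurable_sum => i; exact: measurable_funX.
apply: (@le_trans _ _ (P (E (e / 8) `|` E (- (e / 8))))).
  by apply: le_measure => //; apply/mem_set => //; exact: measurableU.
apply: (le_trans (measureU2 _ _ _)) => //.
rewrite mulr_natl mulr2n EFinD; apply: leeD; apply: PE.
  by rewrite ger0_norm//; lra.
by rewrite normrN ger0_norm//; lra.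
Qed.

End gaussian_squares.

(** * Greedy selection under a strict gap *)

(** A strict gap makes ties harmless: none occurs between [U :\: S] and the outside of [U], so every
    sorted list begins with an enumeration of [U :\: S]. *)
Lemma greedy_spca_of_gap (R : realType) p (f : {set 'I_p} -> R)
    (S U : {set 'I_p}) :
  S \subset U ->
  (forall i j, i \in U -> i \notin S -> j \notin U ->
     f (j |: S)%SET < f (i |: S)%SET) ->
  greedy_spca f S #|U| U.
Proof.
move=> SU gap.
pose le := fun i j : 'I_p => f (j |: S)%SET <= f (i |: S)%SET.
have le_tr : transitive le by move=> b a c ab bc; exact: le_trans bc ab.
have le_total : total le by move=> a b; exact: le_total.
have main s : perm_eq s (enum (~: S)%SET) -> sorted le s ->
    (S :|: [set i in take (#|U| - #|S|) s])%SET = U.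
  move=> ps; rewrite (sorted_pairwise le_tr) => ss.
  have us : uniq s by rewrite (perm_uniq ps) enum_uniq.
  have ms i : (i \in s) = (i \notin S) by rewrite (perm_mem ps) mem_enum inE.
  set m := (#|U| - #|S|)%N; set t := take m s.
  have UDS : #|(U :\: S)%SET| = m by rewrite cardsD (finset.setIidPr SU).
  have mles : (m <= size s)%N.
    rewrite (perm_size ps) -cardE -UDS subset_leq_card//.
    by apply/fintype.subsetP => i; rewrite !inE => /andP[].
  have ut : uniq t by exact: take_uniq.
  have ct : #|[set i in t]%SET| = m by rewrite cardsE (card_uniqP ut) size_takel.
  have tU : {subset t <= (U :\: S)%SET}.
    (* An intruder [i] outside [U] in the prefix would, by counting, push out some [j] of [U :\: S],
       although [j] has the larger score. *)
    move=> i it; rewrite !inE -ms (mem_take it) /=; apply/negPn/negP => iU.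
    have [j jUS jt] : exists2 j, j \in (U :\: S)%SET & j \notin t.
      apply/fintype.subsetPn/negP => USt.
      have USE : (U :\: S = [set i in t])%SET.
        apply/eqP; rewrite eqEcard ct UDS leqnn andbT.
        by apply/fintype.subsetP => j /(fintype.subsetP USt); rewrite inE.
      have : i \in [set i in t]%SET by rewrite inE.
      by rewrite -USE !inE (negPf iU) andbF.
    have [jS jU] : j \notin S /\ j \in U by move: jUS; rewrite inE => /andP[].
    have jd : j \in drop m s.
      by have := ms j; rewrite jS -{1}(cat_take_drop m s) mem_cat -/t (negPf jt).
    move: ss; rewrite -(cat_take_drop m s) pairwise_cat => /andP[/allrelP/(_ i j it jd)].
    by rewrite /le leNgt gap.
  have tE : ([set i in t] = U :\: S)%SET.
    apply/eqP; rewrite eqEcard ct UDS leqnn andbT.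
    by apply/fintype.subsetP => i; rewrite inE => /tU.
  rewrite -/t tE; apply/finset.setP => i; rewrite !inE.
  by have := fintype.subsetP SU i; case: (i \in S) => // ->.
move=> U'; split=> [[s [ps ss ->]]|->]; first exact: main.
(* Conversely [U] has to be an actual output, so one sorted list is exhibited. *)
have pS : perm_eq (sort le (enum (~: S)%SET)) (enum (~: S)%SET) by rewrite perm_sort.
have sS : sorted le (sort le (enum (~: S)%SET)) by exact: sort_sorted.
by exists (sort le (enum (~: S)%SET)); split => //; rewrite main.
Qed.

(** * Measurability of greedy events and the union bound *)

Lemma measurable_finite_table d (T : measurableType d) (I : finType)
    (g : T -> I) (Q : set I) :
  (forall i, measurable (g @^-1` [set i])) -> measurable (g @^-1` Q).
Proof.
move=> mg; rewrite (_ : g @^-1` Q = \bigcup_(i in Q) (g @^-1` [set i])).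
  exact: fin_bigcup_measurable.
apply/seteqP; split=> [w Qw|w [i Qi /= ->]//].
by exists (g w).
Qed.

(* The event only depends on the finite table of comparisons between the
   values of f. *)
Lemma measurable_exists_greedy d (T : measurableType d) (R : realType) p
    (f : T -> {set 'I_p} -> R) (k : nat) (U : {set 'I_p})
    (D : pred {set 'I_p}) :
  (forall A, measurable_fun setT (f ^~ A)) ->
  measurable [set w | exists2 S, D S & greedy_spca (f w) S k U].
Proof.
move=> mf.
pose tab w := [ffun AB : {set 'I_p} * {set 'I_p} => f w AB.1 <= f w AB.2].
pose Q (t : {ffun {set 'I_p} * {set 'I_p} -> bool}) :=
  exists2 S, D S & forall U', (exists s : seq 'I_p,
    [/\ perm_eq s (enum (~: S)%SET),
        sorted (fun i j => t ((j |: S)%SET, (i |: S)%SET)) s &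
        U' = (S :|: [set i in take (k - #|S|) s])%SET]) <-> U' = U.
rewrite (_ : [set w | _] = tab @^-1` Q); last first.
  apply/funext => w; apply/propext; rewrite /Q /=.
  have E S s : sorted (fun i j => tab w ((j |: S)%SET, (i |: S)%SET)) s =
      sorted (fun i j => f w (j |: S)%SET <= f w (i |: S)%SET) s.
    by apply: eq_sorted => i j; rewrite ffunE.
  split=> -[S DS H]; exists S => // U'; rewrite -H; split=> -[s [ps ss UE]];
    exists s; split => //; by rewrite ?E// -E.
apply: measurable_finite_table => t.
rewrite (_ : _ @^-1` _ = \bigcap_(AB in setT)
    (if t AB then [set w | f w AB.1 <= f w AB.2]
     else ~` [set w | f w AB.1 <= f w AB.2])); last first.
  apply/seteqP; split=> [w /= <- AB _|w /= tw].
    by rewrite ffunE; case: ifP => // /negP.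
  apply/ffunP => AB; rewrite ffunE; have := tw AB I.
  by case: (t AB) => //= /negP/negbTE.
apply: fin_bigcap_measurable => [|AB _]; first exact: finite_finset.
have mle : measurable [set w | f w AB.1 <= f w AB.2].
  by rewrite -[X in measurable X]setTI; exact: measurable_fun_le.
by case: ifP => // _; exact: measurableC.
Qed.

Lemma measure_union_bound d (T : measurableType d) (R : realType)
    (mu : {measure set T -> \bar R}) (I : finType) (A : set T)
    (B : I -> set T) (b : R) :
  measurable A -> (forall i, measurable (B i)) -> A `<=` \bigcup_i B i ->
  (forall i, (mu (B i) <= b%:E)%E) -> (mu A <= (#|I|%:R * b)%:E)%E.
Proof.
move=> mA mB AB mub.
have fI : finite_set [set: I] by exact: finite_finset.
apply: (le_trans (content_sub_fsum mu fI (fun i _ => mB i) mA AB)).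
have -> : [set: I] = [set` index_enum I].
  by apply/seteqP; split=> i _ //=; rewrite mem_index_enum.
rewrite -fsbig_seq ?index_enum_uniq//; apply: le_trans (lee_sum _ (fun i _ => mub i)) _.
by rewrite sumEFin sumr_const mulr_natl.
Qed.

(** * Linear forms in the spiked model and the gap of the scores *)

(** Summing a block of a Gram matrix gives the squared norm of a sum of columns: the score becomes a
    sum of squares over the samples, open to Gaussian concentration. *)
Lemma favg_sample_covE (R : realType) n p (X : 'M[R]_(n, p)) (A : {set 'I_p}) :
  favg (sample_cov X) A =
  (#|A|%:R * n%:R)^-1 * \sum_l (\sum_(j in A) X l j) ^+ 2.
Proof.
rewrite /favg invfM -mulrA; congr (_ * _).
transitivity (\sum_(i in A) \sum_(j in A) n%:R^-1 * \sum_l X l i * X l j).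
  apply: eq_bigr => i _; apply: eq_bigr => j _; rewrite !mxE; congr (_ * _).
  by apply: eq_bigr => l _; rewrite !mxE.
under eq_bigr do rewrite -mulr_sumr.
rewrite -mulr_sumr; congr (_ * _).
under eq_bigr do rewrite exchange_big/=.
rewrite exchange_big/=; apply: eq_bigr => l _.
by rewrite expr2 mulr_suml; apply: eq_bigr => i _; rewrite mulr_sumr.
Qed.

Definition linform (R : realType) p (a : 'I_p -> R) (t : p.-tuple R) : R :=
  \sum_j a j * tnth t j.

Lemma measurable_linform (R : realType) p (a : 'I_p -> R) :
  measurable_fun setT (linform a).
Proof.
apply: measurable_sum => j; apply: measurable_funM => //.
exact: measurable_tnth.
Qed.

(** The variance of [linform a] on a sample, that is the quadratic form of [beta v v^T + I] at
    [a]. *)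
Definition spiked_var (R : realType) p (beta : R) (v : 'cV[R]_p)
    (a : 'I_p -> R) : R :=
  beta * (\sum_j a j * v j 0) ^+ 2 + \sum_j a j ^+ 2.

Section spiked_model.
Context d (T : measurableType d) (R : realType) (P : probability T R).
Context (n p k : nat) (beta : R) (v : 'cV[R]_p) (x : 'I_n -> {RV P >-> p.-tuple R}).
Context (model : UBSPCA k beta v x).

Lemma linform_law (a : 'I_p -> R) (l : 'I_n) (B : set R) :
  0 < spiked_var beta v a -> measurable B ->
  P ((linform a \o x l) @^-1` B) =
  normal_prob 0 (Num.sqrt (spiked_var beta v a)) B.
Proof.
case: model => _ _ _ law q0 mB.
have := law l (\row_j a j) B mB.
rewrite [X in P X](_ : _ = (linform a \o x l) @^-1` B); last first.
  congr (_ @^-1` B); apply/funext => w; rewrite mxE /linform /=.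
  by apply: eq_bigr => j _; rewrite !mxE.
move=> ->; rewrite trmx0 mulmx0 mxE.
have -> : (\row_j a j *m (beta *: (v *m v^T) + 1%:M) *m (\row_j a j)^T) 0 0 =
    spiked_var beta v a.
  rewrite mulmxDr mulmxDl mulmx1 mxE -scalemxAr -scalemxAl mxE; congr (_ * _ + _).
    rewrite mulmxA -[_ *m v^T *m _]mulmxA mxE big_ord1 expr2; congr (_ * _).
      by rewrite mxE; apply: eq_bigr => j _; rewrite mxE.
    by rewrite mxE; apply: eq_bigr => j _; rewrite !mxE mulrC.
  by rewrite mxE; apply: eq_bigr => j _; rewrite !mxE expr2.
(* Positive variance selects the non-degenerate branch of [gauss1]. *)
by rewrite /gauss1 gt_eqF.
Qed.

Definition bad_form (e : R) (a : 'I_p -> R) : set T :=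
  [set w | e * (n%:R * spiked_var beta v a) <=
    `| \sum_l linform a (x l w) ^+ 2 - n%:R * spiked_var beta v a |].

Lemma measurable_linform_data (a : 'I_p -> R) l :
  measurable_fun setT (linform a \o x l).
Proof. by apply: measurableT_comp => //; exact: measurable_linform. Qed.

Lemma measurable_bad_form (e : R) (a : 'I_p -> R) : measurable (bad_form e a).
Proof.
rewrite -[X in measurable X]setTI; apply: measurable_fun_le => //.
apply: measurableT_comp => //; apply: measurable_funB => //.
apply: measurable_sum => l; apply: measurable_funX.
exact: measurable_linform_data.
Qed.

Lemma bad_form_prob (e : R) (a : 'I_p -> R) :
  0 < spiked_var beta v a -> 0 < e <= 2 ->
  (P (bad_form e a) <= (2 * expR (- (n%:R * e ^+ 2 / 16)))%:E)%E.
Proof.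
move=> q0 e02; have [_ _ indep _] := model.
have s0 : 0 < Num.sqrt (spiked_var beta v a) by rewrite sqrtr_gt0.
have := @normal_sqr_concentration _ _ _ P n (fun l => linform a \o x l)
  (Num.sqrt (spiked_var beta v a)) e (measurable_linform_data a) s0 e02.
rewrite sqr_sqrtr; last exact: ltW.
apply => [l B mB|A mA]; first exact: linform_law.
apply: (indep (fun l => linform a @^-1` A l)) => l.
rewrite -[X in measurable X]setTI; apply: measurable_linform => //.
Qed.

End spiked_model.

(* Coefficients of the linear form al x_i + ga \sum_(j in S) x_j. *)
Definition seed_form (R : realType) p (al ga : R) (S : {set 'I_p})
    (i j : 'I_p) : R :=
  al * (j == i)%:R + ga * (j \in S)%:R.

Lemma sum_seed_form (R : realType) p (al ga : R) (S : {set 'I_p}) i (y : 'I_p -> R) :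
  \sum_j seed_form al ga S i j * y j = al * y i + ga * \sum_(j in S) y j.
Proof.
under eq_bigr do rewrite mulrDl.
rewrite big_split/= (bigD1 i)//= eqxx mulr1 big1 ?addr0; last first.
  by move=> j /negbTE ->; rewrite mulr0 mul0r.
congr (_ + _); rewrite mulr_sumr [RHS]big_mkcond; apply: eq_bigr => j _.
by case: (j \in S); rewrite ?mulr1// mulr0 mul0r.
Qed.

(** Since [i] lies outside [S], the two pieces of the form do not overlap and the squared norm has
    no cross term; the entries [1 / sqrt k] of the spike produce the factor [beta / k]. *)
Lemma spiked_var_seed_form (R : realType) p k (beta al ga : R) (v : 'cV[R]_p)
    (S : {set 'I_p}) i :
  uniform_biased_spike k v -> S \subset vsupp v -> i \notin S ->
  spiked_var beta v (seed_form al ga S i) =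
  beta / k%:R * (al * (i \in vsupp v)%:R + ga * #|S|%:R) ^+ 2 +
    (al ^+ 2 + ga ^+ 2 * #|S|%:R).
Proof.
move=> [_ _ vE] Sv iS.
have vE' j : v j 0 = (Num.sqrt k%:R)^-1 * (j \in vsupp v)%:R.
  case: (boolP (j \in vsupp v)) => [/vE ->|]; first by rewrite mulr1.
  by rewrite inE negbK mulr0 => /eqP.
rewrite /spiked_var sum_seed_form; congr (_ + _).
  rewrite vE' (eq_bigr (fun=> (Num.sqrt k%:R)^-1)); last first.
    by move=> j /(fintype.subsetP Sv)/vE.
  rewrite sumr_const -[_ *+ #|S|]mulr_natr.
  rewrite (_ : al * _ + _ = (Num.sqrt k%:R)^-1 *
    (al * (i \in vsupp v)%:R + ga * #|S|%:R)); last by ring.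
  rewrite exprMn exprVn sqr_sqrtr ?ler0n//.
  by rewrite mulrA.
under eq_bigr do rewrite expr2.
rewrite sum_seed_form /seed_form eqxx (negPf iS) !mulr0 addr0 mulr1 expr2.
congr (_ + _); rewrite (eq_bigr (fun=> ga)).
  by rewrite sumr_const -[_ *+ #|S|]mulr_natr expr2 mulrA.
move=> j jS; rewrite jS mulr1; case: eqP => [ji|_]; last by rewrite mulr0 add0r.
by rewrite -ji jS in iS.
Qed.

(* Qp, Qm and Q0 stand for the sums over the N samples of (r x_i + y)^2,
   (r x_i - y)^2 and x_i^2, where h = beta / k, s = |S|, and dl is 1 or 0
   according to whether i belongs to the support. *)
Lemma polarized_deviation (R : realFieldType) (N e r h s dl Qp Qm Q0 : R) :
  0 < r -> 0 < e * N -> 0 <= h -> 0 <= s -> dl = 0 \/ dl = 1 ->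
  1 <= r -> r ^+ 2 = s + 1 ->
  let qp := h * (r * dl + s) ^+ 2 + (r ^+ 2 + s) in
  let qm := h * (r * dl - s) ^+ 2 + (r ^+ 2 + s) in
  let q0 := h * dl + 1 in
  `|Qp - N * qp| < e * (N * qp) ->
  `|Qm - N * qm| < e * (N * qm) ->
  `|Q0 - N * q0| < e * (N * q0) ->
  `|Q0 + (Qp - Qm) / (2 * r) - N * (1 + h * dl * (2 * s + 1))|
    < e * N * (3 * r * (1 + r ^+ 2 * h)).
Proof.
move=> r0 eN0 h0 s0 dl01 r1 rs qp qm q0 Hp Hm H0.
have dl2 : dl ^+ 2 = dl by case: dl01 => ->; ring.
have r20 : 0 < (2 * r)^-1 by rewrite invr_gt0; lra.
(* Polarisation is exact on the expectations, so only the three deviations are left. *)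
have -> : Q0 + (Qp - Qm) / (2 * r) - N * (1 + h * dl * (2 * s + 1)) =
    (Q0 - N * q0) + ((Qp - N * qp) - (Qm - N * qm)) / (2 * r).
  by rewrite /q0 /qp /qm; field; rewrite gt_eqF.
apply: (@lt_le_trans _ _ (e * (N * q0) + (e * (N * qp) + e * (N * qm)) / (2 * r))).
  apply: le_lt_trans (ler_normD _ _) _; apply: ltr_leD => //.
  rewrite normrM (gtr0_norm r20) ler_pM2r//.
  by apply: le_trans (ler_normB _ _) _; apply: lerD; exact: ltW.
have -> : e * (N * q0) + (e * (N * qp) + e * (N * qm)) / (2 * r) =
    e * N * (q0 + (qp + qm) / (2 * r)) by field; rewrite gt_eqF.
rewrite ler_pM2l//.
(* The cross terms [2 r dl s] cancel in the sum. *)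
have -> : qp + qm = 2 * (h * (r ^+ 2 * dl + s ^+ 2) + (r ^+ 2 + s)).
  by rewrite /qp /qm -{3}dl2; ring.
have -> : 2 * (h * (r ^+ 2 * dl + s ^+ 2) + (r ^+ 2 + s)) / (2 * r) =
    (h * (r ^+ 2 * dl + s ^+ 2) + (r ^+ 2 + s)) / r by field; rewrite gt_eqF.
rewrite -lerBrDl ler_pdivrMr//.
have dl1 : 0 <= dl <= 1 by case: dl01 => ->; rewrite ?lexx ?ler01.
have -> : (3 * r * (1 + r ^+ 2 * h) - q0) * r =
  r ^+ 2 * 3 + 3 * r ^+ 2 * r ^+ 2 * h - r - h * dl * r by rewrite /q0; ring.
rewrite rs.
have r2 : r <= s + 1 by rewrite -rs expr2; nra.
have hd : 0 <= h * dl <= h by case: dl01 => ->; rewrite ?mulr0 ?mulr1 ?lexx ?h0.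
have rdl : h * dl * r <= h * (s + 1) by apply: ler_pM => //; case/andP: hd => //; lra.
have hs1 : 0 <= h * s by exact: mulr_ge0.
have hs2 : 0 <= h * s * s by exact: mulr_ge0.
have hds : h * dl * s <= h * s by rewrite ler_wpM2r//; case/andP: hd.
case/andP: hd => hd0 hd1.
nra.
Qed.

(** Up to normalisation and a common term, each score deviates by less than [3 e n r (1 + r^2 h)]
    with [h = beta / k], while the expectations differ by [n h (2 s + 1)]. The two conditions on [e]
    make twice the deviation at most this gap. *)
Lemma favg_gap (R : realType) n p k (beta e r : R) (v : 'cV[R]_p)
    (S : {set 'I_p}) (X : 'I_n -> p.-tuple R) :
  let good al ga i :=
    `|\sum_l linform (seed_form al ga S i) (X l) ^+ 2 -
       n%:R * spiked_var beta v (seed_form al ga S i)| <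
     e * (n%:R * spiked_var beta v (seed_form al ga S i)) in
  uniform_biased_spike k v -> S \subset vsupp v -> 0 <= beta ->
  (0 < n)%N -> 0 < e -> 1 <= r -> r ^+ 2 = #|S|%:R + 1 ->
  12 * e <= r * (beta / k%:R) -> 12 * e * r <= 1 ->
  (forall i, i \notin S -> [/\ good r 1 i, good r (- 1) i & good 1 0 i]) ->
  forall i j, i \in vsupp v -> i \notin S -> j \notin vsupp v ->
  favg (sample_cov (\matrix_(l, i) tnth (X l) i)) (j |: S)%SET <
  favg (sample_cov (\matrix_(l, i) tnth (X l) i)) (i |: S)%SET.
Proof.
move=> good spike Sv beta0 n0 e0 r1 rs er1 er2 H i j iv iS jv.
have jS : j \notin S by apply: contra jv; exact: (fintype.subsetP Sv).
have r0 : 0 < r by lra.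
have N0 : 0 < n%:R :> R by rewrite ltr0n.
set h := beta / k%:R; have h0 : 0 <= h by rewrite divr_ge0.
pose s : R := #|S|%:R; have s0 : 0 <= s by rewrite ler0n.
pose y l := \sum_(m in S) tnth (X l) m.
pose D (m : 'I_p) := \sum_l (tnth (X l) m + y l) ^+ 2.
(* Competing sets all have size [|S| + 1], so their normalising factors agree. *)
have favgE m : m \notin S ->
    favg (sample_cov (\matrix_(l, i) tnth (X l) i)) (m |: S)%SET =
    ((#|S|.+1)%:R * n%:R)^-1 * D m.
  move=> mS; rewrite favg_sample_covE cardsU1 mS add1n; congr (_ * _).
  apply: eq_bigr => l _; rewrite (big_setU1 m mS)/= mxE; congr ((_ + _) ^+ 2).
  by apply: eq_bigr => ? _; rewrite mxE.
rewrite !favgE// ltr_pM2l ?invr_gt0 ?mulr_gt0 ?ltr0n//.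
have dev m : m \notin S ->
    `|D m - \sum_l y l ^+ 2 - n%:R * (1 + h * (m \in vsupp v)%:R * (2 * s + 1))| <
    e * n%:R * (3 * r * (1 + r ^+ 2 * h)).
  move=> mS; have [] := H m mS; rewrite /good.
  rewrite !(spiked_var_seed_form _ _ _ spike Sv mS) -/h -/s.
  pose Q al ga := \sum_l linform (seed_form al ga S m) (X l) ^+ 2.
  rewrite -/(Q r 1) -/(Q r (-1)) -/(Q 1 0).
  (* The sum of [y^2] is common to all candidates, and [2 x y = ((r x + y)^2 - (r x - y)^2) / (2
     r)]. *)
  have -> : D m - \sum_l y l ^+ 2 = Q 1 0 + (Q r 1 - Q r (-1)) / (2 * r).
    rewrite /D /Q -!sumrB mulr_suml -big_split/=; apply: eq_bigr => l _.
    rewrite /linform !sum_seed_form -/(y l); field; rewrite gt_eqF//.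
  rewrite expr1n sqrrN expr1n !mul1r expr0n/= !mul0r !addr0 mulN1r.
  have -> : (m \in vsupp v)%:R ^+ 2 = (m \in vsupp v)%:R :> R.
    by case: (_ \in _); rewrite ?expr1n ?expr0n.
  apply: polarized_deviation => //; first exact: mulr_gt0.
  by case: (_ \in _); [right|left].
have := dev j jS; have := dev i iS; rewrite iv (negPf jv) mulr0 mul0r addr0 !mulr1.
rewrite !ltr_norml => /andP[Hi _] /andP[_ Hj].
suff : 2 * (e * n%:R * (3 * r * (1 + r ^+ 2 * h))) <= n%:R * (h * (2 * s + 1)) by lra.
rewrite [leLHS](_ : _ = n%:R * (6 * e * r * (1 + r ^+ 2 * h))); last by ring.
rewrite ler_pM2l//.
have r2h : 0 <= r ^+ 2 * h by rewrite mulr_ge0// exprn_ge0// ltW.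
(* Each of [6 e r] and [6 e r (r^2 h)] is at most half of [r^2 h], and [r^2 = s + 1 <= 2 s + 1]. *)
have A1 : 12 * e * r <= r ^+ 2 * h.
  have -> : r ^+ 2 * h = r * h * r by ring.
  by rewrite ler_pM2r.
have A2 : 12 * e * r * (r ^+ 2 * h) <= r ^+ 2 * h by rewrite ler_piMl.
have A3 : r ^+ 2 * h <= h * (2 * s + 1) by rewrite rs -/s mulrC ler_wpM2l//; lra.
lra.
Qed.

(** * Success probability for one seed *)

Definition seed_success d (T : measurableType d) (R : realType)
    (P : probability T R) (n p k kstar : nat) (v : 'cV[R]_p)
    (x : 'I_n -> {RV P >-> p.-tuple R}) : set T :=
  [set w | exists S : {set 'I_p},
     [/\ S \subset vsupp v, (#|S| <= kstar)%N &
         greedy_spca (favg (sample_cov (data_matrix x w))) S k (vsupp v)]].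

(** Measurability allows passing to the complementary event in the union bound. *)
Lemma measurable_seed_success d (T : measurableType d) (R : realType)
    (P : probability T R) (n p k kstar : nat) (v : 'cV[R]_p)
    (x : 'I_n -> {RV P >-> p.-tuple R}) :
  measurable (seed_success k kstar v x).
Proof.
pose D := [pred S : {set 'I_p} | (S \subset vsupp v) && (#|S| <= kstar)%N].
have := @measurable_exists_greedy _ T R p
  (fun w => favg (sample_cov (data_matrix x w))) k (vsupp v) D.
rewrite (_ : [set w | _] = seed_success k kstar v x); last first.
  apply/seteqP; split=> [w [S /andP[S1 S2] S3]|w [S [S1 S2 S3]]]; exists S => //.
  by rewrite /D /= S1.
apply => A; under eq_fun do rewrite favg_sample_covE.
apply: measurable_funM => //; apply: measurable_sum => l.
apply: measurable_funX.
under eq_fun do (under eq_bigr do rewrite mxE).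
rewrite (_ : (fun w => _) = (fun w => \sum_(j <- enum A) tnth (x l w) j)).
  apply: measurable_sum => j.
  by apply: (measurableT_comp (@measurable_tnth _ _ _ j)).
by apply/funext => w; rewrite big_enum.
Qed.

(** One fixed seed suffices: outside the bad events of the [3 p] forms the gap holds, and each has
    probability at most [2 expR (- n e^2 / 16)], hence the factor 6. *)
Lemma seed_success_prob d (T : measurableType d) (R : realType)
    (P : probability T R) (n p k kstar : nat) (beta e r : R) (v : 'cV[R]_p)
    (x : 'I_n -> {RV P >-> p.-tuple R}) (S : {set 'I_p}) :
  UBSPCA k beta v x -> S \subset vsupp v -> (#|S| <= kstar)%N ->
  (0 < n)%N -> 0 < e <= 2 -> 1 <= r -> r ^+ 2 = #|S|%:R + 1 ->
  12 * e <= r * (beta / k%:R) -> 12 * e * r <= 1 ->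
  ((1 - 6 * p%:R * expR (- (n%:R * e ^+ 2 / 16)))%:E <=
    P (seed_success k kstar v x))%E.
Proof.
move=> model Sv Sk n0 /[dup] e02 /andP[e0 _] r1 rs er1 er2.
have [beta0 spike _ _] := model.
(* [Some true] and [Some false] encode [r x_i + y] and [r x_i - y], [None] encodes [x_i] alone. *)
pose form (ic : 'I_p * option bool) := match ic.2 with
  | None => seed_form 1 0 S ic.1
  | Some b => seed_form r (if b then 1 else - 1) S ic.1 end.
(* Indices in [S] are never scored, so they get the empty event. *)
pose B ic := if ic.1 \in S then set0 else bad_form beta v x e (form ic).
have mB ic : measurable (B ic).
  rewrite /B; case: ifP => // _; exact: measurable_bad_form.
have b0 : 0 <= 2 * expR (- (n%:R * e ^+ 2 / 16)) :> R.
  by rewrite mulr_ge0// expR_ge0.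
have PB ic : (P (B ic) <= (2 * expR (- (n%:R * e ^+ 2 / 16)))%:E)%E.
  rewrite /B; case: ifPn => [_|iS]; first by rewrite measure0 lee_fin.
  apply: (bad_form_prob model) => //.
  have pos al ga : 1 <= al -> 0 < spiked_var beta v (seed_form al ga S ic.1).
    move=> al1; rewrite (spiked_var_seed_form _ _ _ spike Sv iS).
    apply: ltr_wpDl; first by rewrite mulr_ge0 ?sqr_ge0// divr_ge0.
    apply: ltr_pwDl; first by rewrite exprn_gt0//; lra.
    by rewrite mulr_ge0 ?sqr_ge0.
  by rewrite /form; case: ic.2 => [b|]; apply: pos.
have mE := @measurable_seed_success _ _ _ P n p k kstar v x.
have EB : ~` seed_success k kstar v x `<=` \bigcup_ic B ic.
  move=> w notE; apply: contrapT => noB; apply: notE; exists S; split=> //.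
  have good ic : ic.1 \notin S ->
      `|\sum_l linform (form ic) (x l w) ^+ 2 - n%:R * spiked_var beta v (form ic)|
      < e * (n%:R * spiked_var beta v (form ic)).
    move=> iS; rewrite ltNge; apply/negP => bad; apply: noB; exists ic => //.
    by rewrite /B (negPf iS).
  have [_ <- _] := spike.
  apply: greedy_spca_of_gap => // i j iv iS jv.
  apply: (@favg_gap _ _ _ k beta e r v S (fun l => x l w)) => // {iv iS jv}i iS.
  by split; [exact: (good (i, Some true))|exact: (good (i, Some false))|
             exact: (good (i, None))].
have : (P (~` seed_success k kstar v x) <= _)%E :=
  measure_union_bound (measurableC mE) mB EB PB.
rewrite (probability_setC P mE) card_prod card_option card_bool card_ord.
rewrite -(fineK (fin_num_measure P _ mE)).
rewrite -EFinB !lee_fin natrM; lra.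
Qed.

(* L stands for ln n / n and K for k; 32 makes n e^2 / 16 equal to 2 ln n. *)
Lemma seed_parameters (R : realType) (C L beta K s : R) :
  100 * 100 <= C -> 0 < L -> L * (100 * 100) <= 1 -> 0 < beta -> 1 <= K -> 0 <= s ->
  C * L * K <= beta ^+ 2 -> C * L * K <= beta ->
  s <= C * K ^+ 2 * L / beta ^+ 2 <= s + 1 ->
  let e := Num.sqrt (32 * L) in let r := Num.sqrt (s + 1) in
  [/\ 0 < e <= 2, s <= K, 12 * e <= r * (beta / K) & 12 * e * r <= 1].
Proof.
move=> C1 L0 L1 b0 K1 s0 H2 H1 /andP[sQ Qs] e r.
have e2 : e ^+ 2 = 32 * L by rewrite sqr_sqrtr//; lra.
have r2 : r ^+ 2 = s + 1 by rewrite sqr_sqrtr//; lra.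
have e0 : 0 < e by rewrite sqrtr_gt0; lra.
have r0 : 0 < r by rewrite sqrtr_gt0; lra.
have K0 : 0 < K by lra.
have C0 : 0 < C by lra.
have b20 : 0 < beta ^+ 2 by exact: exprn_gt0.
have K20 : 0 < K ^+ 2 by exact: exprn_gt0.
have bK0 : 0 < beta / K by exact: divr_gt0.
have sb : s * beta ^+ 2 <= C * K ^+ 2 * L by rewrite -ler_pdivlMr.
have sb1 : C * K ^+ 2 * L <= (s + 1) * beta ^+ 2 by rewrite -ler_pdivrMr.
split.
- rewrite e0 /= -ler_sqr ?nnegrE ?(ltW e0)// e2; lra.
(* [C L K <= beta^2] keeps the seed no larger than the support. *)
- rewrite -(ler_pM2r b20); apply: le_trans sb _.
  rewrite (_ : C * K ^+ 2 * L = K * (C * L * K)); last by ring.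
  by rewrite ler_pM2l.
(* After squaring, the lower bound on [s + 1] reduces this to [144 * 32 <= C]. *)
- have e120 : 0 <= 12 * e by rewrite mulr_ge0// ltW.
  have rbK0 : 0 <= r * (beta / K) by rewrite ltW// mulr_gt0.
  rewrite -ler_sqr ?nnegrE//.
  rewrite !exprMn exprVn e2 r2 mulrA ler_pdivlMr//.
  apply: le_trans sb1.
  rewrite (_ : 12 ^+ 2 * (32 * L) * K ^+ 2 = 144 * 32 * (K ^+ 2 * L)); last by ring.
  rewrite (_ : C * _ * _ = C * (K ^+ 2 * L)); last by ring.
  by rewrite ler_pM2r ?mulr_gt0//; lra.
(* [C L K <= beta] gives [s L C <= 1]. Then [s L] and [L] are both at most [10^-4], and
   [2 * 144 * 32 <= 10^4] explains the constant. *)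
- have er0 : 0 <= 12 * e * r by rewrite !mulr_ge0 ?(ltW e0) ?(ltW r0).
  rewrite -ler_sqr ?nnegrE// !exprMn e2 r2.
  have CLK0 : 0 <= C * L * K by rewrite !mulr_ge0// ltW.
  have sLC : s * L * C <= 1.
    rewrite -(ler_pM2r b20) mul1r.
    apply: (@le_trans _ _ ((C * L * K) ^+ 2)); last first.
      by rewrite ler_sqr ?nnegrE// ltW.
    rewrite (_ : s * L * C * _ = (L * C) * (s * beta ^+ 2)); last by ring.
    rewrite (_ : (C * L * K) ^+ 2 = (L * C) * (C * K ^+ 2 * L)); last by ring.
    by rewrite ler_pM2l// mulr_gt0.
  have sL0 : 0 <= s * L by rewrite mulr_ge0// ltW.
  have sL1 : s * L * (100 * 100) <= 1 by apply: le_trans sLC; rewrite ler_wpM2l.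
  rewrite expr1n (_ : 12 ^+ 2 * _ * _ = 144 * 32 * (s * L) + 144 * 32 * L); last by ring.
  lra.
Qed.

(** * Size of [ln n / n] and choice of the seed *)

Lemma ln_div_lt (R : realType) (y : R) : 0 < y -> ln y / y < 2 / Num.sqrt y.
Proof.
move=> y0; have q0 : 0 < Num.sqrt y by rewrite sqrtr_gt0.
have -> : ln y = 2 * ln (Num.sqrt y).
  by rewrite -{1}(sqr_sqrtr (ltW y0)) lnXn// mulr_natl.
rewrite ltr_pdivrMr// -{3}(sqr_sqrtr (ltW y0)) expr2 mulrA divfK ?gt_eqF//.
by rewrite ltr_pM2l// ln_sublinear.
Qed.

Lemma exists_subset_card (I : finType) (A : {set I}) (s : nat) :
  (s <= #|A|)%N -> exists2 S : {set I}, S \subset A & #|S| = s.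
Proof.
move=> sA; exists [set i in take s (enum A)]%SET.
  by apply/fintype.subsetP => i; rewrite inE => /mem_take; rewrite mem_enum.
by rewrite cardsE (card_uniqP _) ?take_uniq ?enum_uniq// size_takel -?cardE.
Qed.

(** The seed is any subset of the support whose size is the integer part of
    [C k^2 ln n / (beta^2 n)]. With [n e^2 / 16 = 2 ln n] the failure bound becomes
    [6 (p / n) / n]. *)
Lemma seed_success_prob_param d (T : measurableType d) (R : realType)
    (P : probability T R) (n p k kstar : nat) (C beta : R) (v : 'cV[R]_p)
    (x : 'I_n -> {RV P >-> p.-tuple R}) :
  UBSPCA k beta v x -> 100 * 100 <= C -> (1 <= k)%N ->
  (2 * (100 * 100)) ^+ 2 <= n%:R :> R ->
  k%:R <= n%:R * Num.min (beta ^+ 2) beta / (C * ln n%:R) ->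
  Num.floor (C * k%:R ^+ 2 * ln n%:R / (beta ^+ 2 * n%:R)) <= kstar%:Z ->
  ((1 - 6 * (p%:R / n%:R) * n%:R^-1)%:E <= P (seed_success k kstar v x))%E.
Proof.
move=> model C1 k1 nbig kle flo; have [beta0 [_ vk _] _ _] := model.
have n1 : 1 < n%:R :> R by apply: lt_le_trans nbig; rewrite expr2; lra.
have N0 : 0 < n%:R :> R by lra.
have n0 : (0 < n)%N by rewrite -(ltr0n R).
have lnn0 : 0 < ln (n%:R : R) by exact: ln_gt0.
pose L : R := ln n%:R / n%:R.
have L0 : 0 < L by exact: divr_gt0.
(* The lower bound on [n] gives [sqrt n >= 2 * 10^4], so [L < 2 / sqrt n <= 10^-4]. *)
have L1 : L * (100 * 100) <= 1.
  have q : 2 * (100 * 100) <= Num.sqrt n%:R :> R.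
    rewrite -(@ger0_norm _ (2 * (100 * 100) : R)); last by lra.
    by rewrite -sqrtr_sqr ler_sqrt// ltW.
  have q0 : 0 < Num.sqrt n%:R :> R by rewrite sqrtr_gt0.
  have : L * Num.sqrt n%:R <= 2.
    by rewrite -ler_pdivlMr// ltW// ln_div_lt.
  move=> H; have : L * (2 * (100 * 100)) <= 2.
    by apply: le_trans H; rewrite ler_pM2l.
  lra.
have C0 : 0 < C by lra.
have K1 : 1 <= k%:R :> R by rewrite ler1n.
have CLK : C * L * k%:R <= Num.min (beta ^+ 2) beta.
  move: kle; rewrite ler_pdivlMr ?mulr_gt0// => kle.
  rewrite -(ler_pM2l N0); apply: le_trans kle.
  rewrite le_eqVlt; apply/orP; left; apply/eqP.
  by rewrite /L; field; rewrite gt_eqF.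
have CLK0 : 0 < C * L * k%:R by rewrite (mulr_gt0 (mulr_gt0 C0 L0))// ltr0n.
(* As [k >= 1], the upper bound on [k] excludes [beta = 0]. *)
have bpos : 0 < beta.
  by apply: lt_le_trans CLK0 (le_trans CLK _); rewrite ge_min lexx orbT.
set Q := C * k%:R ^+ 2 * ln n%:R / (beta ^+ 2 * n%:R) in flo.
have QE : Q = C * k%:R ^+ 2 * L / beta ^+ 2.
  by rewrite /Q /L; field; rewrite !gt_eqF.
have Q0 : 0 <= Q.
  by rewrite QE divr_ge0 ?sqr_ge0// (mulr_ge0 _ (ltW L0))// mulr_ge0 ?sqr_ge0// ltW.
have /andP[sQ Qs] := truncn_itv Q0.
(* Since [Q >= 0], truncation is the floor; both bounds say [Q < kstar + 1]. *)
have sk : (Num.truncn Q <= kstar)%N.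
  by rewrite truncn_le_nat -[_%:R]/(kstar.+1%:~R) -floor_lt_int -addn1 PoszD ltzD1.
have [] := @seed_parameters R C L beta k%:R (Num.truncn Q)%:R
  C1 L0 L1 bpos K1 (ler0n _ _).
- by apply: le_trans CLK _; rewrite ge_min lexx.
- by apply: le_trans CLK _; rewrite ge_min lexx orbT.
- by rewrite -QE sQ natr1 ltW.
move=> e02 sK er1 er2.
have [S Sv cS] : exists2 S : {set 'I_p}, S \subset vsupp v & #|S| = Num.truncn Q.
  by apply: exists_subset_card; rewrite vk -(ler_nat R).
have s1 : 0 <= (Num.truncn Q)%:R + 1 :> R by rewrite addr_ge0.
apply: le_trans (seed_success_prob model Sv _ n0 e02 _ _ er1 er2); last first.
- by rewrite cS sqr_sqrtr.
- by rewrite -[leLHS]sqrtr1 ler_sqrt ?lerDr// addr_ge0.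
- by rewrite cS.
rewrite lee_fin lerD2l lerN2.
have -> : n%:R * Num.sqrt (32 * L) ^+ 2 / 16 = 2 * ln n%:R.
  have L32 : 0 <= 32 * L by rewrite pmulr_rge0// ltW.
  by rewrite (sqr_sqrtr L32) /L; field; rewrite gt_eqF.
rewrite expRN expRM_natl lnK ?posrE// le_eqVlt; apply/orP; left; apply/eqP.
by field; rewrite gt_eqF.
Qed.

Theorem theorem4p2 (R : realType) :
  exists2 C0 : R, 0 < C0 &
  forall (C : R), C0 <= C ->
  forall (c : R) (n p k kstar : nat -> nat) (beta : nat -> R)
    (d : nat -> measure_display) (T : forall m, measurableType (d m))
    (P : forall m, probability (T m) R)
    (v : forall m, 'cV[R]_(p m))
    (x : forall m, 'I_(n m) -> {RV (P m) >-> (p m).-tuple R}),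
  (forall m, UBSPCA (k m) (beta m) (v m) (x m)) ->
  n @ \oo --> \oo -> p @ \oo --> \oo -> k @ \oo --> \oo ->
  0 <= c ->
  ((p m)%:R / (n m)%:R : R) @[m --> \oo] --> c ->
  (\forall m \near \oo,
     (k m)%:R <= (n m)%:R * Num.min (beta m ^+ 2) (beta m)
                 / (C * ln (n m)%:R)) ->
  (\forall m \near \oo,
     Num.floor (C * (k m)%:R ^+ 2 * ln (n m)%:R
                / (beta m ^+ 2 * (n m)%:R)) <= (kstar m)%:Z) ->
  P m [set w | exists S : {set 'I_(p m)},
         [/\ S \subset vsupp (v m),
             (#|S| <= kstar m)%N &
             greedy_spca (favg (sample_cov (data_matrix (x m) w)))
               S (k m) (vsupp (v m))]]
    @[m --> \oo] --> 1%E.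
Proof.
exists (100 * 100); first lra.
move=> C C1 c n p k kstar beta d T P v x model ninf _ kinf _ pn kle flo.
(* [p / n] converges and [n^-1] tends to 0, so this lower bound tends to 1. *)
pose lb m : R := 1 - 6 * ((p m)%:R / (n m)%:R) * (n m)%:R^-1.
have nR : ((n m)%:R : R) @[m --> \oo] --> +oo.
  by apply/cvgrnyP.
have lb1 : lb m @[m --> \oo] --> (1 : R).
  rewrite -[X in _ --> X](subr0 (1 : R)) -(mulr0 (6 * c)).
  apply: cvgB; first exact: cvg_cst.
  apply: cvgM; first exact: cvgMl_tmp.
  apply/gtr0_cvgV0 => //.
  near=> m; rewrite ltr0n; near: m.
  by move/cvgnyPgt: ninf; exact.
apply: (@squeeze_cvge _ _ _ _ (EFin \o lb) _ (cst 1%E)).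
- near=> m; apply/andP; split; last first.
    by apply: probability_le1; exact: measurable_seed_success.
  apply: (@seed_success_prob_param _ _ _ _ _ _ _ _ C (beta m)) => //.
  + by near: m; move/cvgnyPge: kinf; exact.
  + by near: m; move/cvgryPge: nR; exact.
  + by near: m.
  + by near: m.
- by apply: cvg_EFin; [exact: nearW|exact: lb1].
- exact: cvg_cst.
Unshelve. all: by end_near.
Qed.
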